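(* Let $0<|q|<1$, $0<|p|<1$, $0<|x|<1$, $0<|y|<1$. (I) Let $a,b,c,d\in\mathbb{C}$ with $p^{c}\neq p^{-n}$ and $q^{d}\ne q^{-n}$ for all integers $n\ge 0$; write $\Psi_1(x,y)=\Psi_{1}(q^{a},p^{b};p^{c},q^{d};q,p,x,y)$. If $q^a\neq 1$, then $$\mathbb{D}_{a,q}\Psi_{1}(x,y)=-\frac{1}{1-q^{a}}\Big[x\mathbb{D}_{x,q}\Psi_{1}(x,y)+\frac{1-p}{1-q}\,y\mathbb{D}_{y,p}\Psi_{1}(qx,y)+\frac{1}{1-q}\Psi_{1}(qx,py)-\frac{1}{1-q}\Psi_{1}(qx,qy)\Big],$$ $$\mathbb{D}_{a,q}\Psi_{1}(x,y)=-\frac{1}{1-q^{a}}\Big[\frac{1-p}{1-q}\,y\mathbb{D}_{y,p}\Psi_{1}(x,y)+x\mathbb{D}_{x,q}\Psi_{1}(x,qy)+\frac{1}{1-q}\Psi_{1}(x,py)-\frac{1}{1-q}\Psi_{1}(x,qy)\Big].$$ Also $$\mathbb{D}_{d,q}\Psi_{1}(x,y)=\frac{1}{1-q^{d}}\,x\mathbb{D}_{x,q}\Psi_{1}(q^{a},p^{b};p^{c},q^{d+1};q,p,x,y),$$ $$\mathbb{D}_{b,p}\Psi_{1}(x,y)=-\frac{1}{1-p^{b}}\,y\mathbb{D}_{y,p}\Psi_{1}(x,y)\quad(\text{if }p^{b}\neq1),$$ $$\mathbb{D}_{c,p}\Psi_{1}(x,y)=\frac{1}{1-p^{c}}\,y\mathbb{D}_{y,p}\Psi_{1}(q^{a},p^{b};p^{c+1},q^{d};q,p,x,y).$$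 (II) Let $a,b,c\in\mathbb{C}$ with $p^{b}\neq p^{-n}$ and $q^{c}\ne q^{-n}$ for all integers $n\ge 0$; write $\Psi_2(x,y)=\Psi_{2}(q^{a};p^{b},q^{c};q,p,x,y)$. If $q^{a}\neq1$, then $$\mathbb{D}_{a,q}\Psi_{2}(x,y)=-\frac{1}{1-q^{a}}\Big[x\mathbb{D}_{x,q}\Psi_{2}(x,y)+\frac{1-p}{1-q}\,y\mathbb{D}_{y,p}\Psi_{2}(qx,y)+\frac{1}{1-q}\Psi_{2}(qx,py)-\frac{1}{1-q}\Psi_{2}(qx,qy)\Big],$$ $$\mathbb{D}_{a,q}\Psi_{2}(x,y)=-\frac{1}{1-q^{a}}\Big[\frac{1-p}{1-q}\,y\mathbb{D}_{y,p}\Psi_{2}(x,y)+x\mathbb{D}_{x,q}\Psi_{2}(x,qy)+\frac{1}{1-q}\Psi_{2}(x,py)-\frac{1}{1-q}\Psi_{2}(x,qy)\Big].$$ Also $$\mathbb{D}_{c,q}\Psi_{2}(x,y)=\frac{1}{1-q^{c}}\,x\mathbb{D}_{x,q}\Psi_{2}(q^{a};p^{b},q^{c+1};q,p,x,y),\qquad \mathbb{D}_{b,p}\Psi_{2}(x,y)=\frac{1}{1-p^{b}}\,y\mathbb{D}_{y,p}\Psi_{2}(q^{a};p^{b+1},q^{c};q,p,x,y).$$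
   Context: $q,p\in\mathbb{C}$ are two independent bases with $0<|q|<1$, $0<|p|<1$; logarithms of $q$ and $p$ are fixed so that $q^{a}=e^{a\log q}$, $p^{b}=e^{b\log p}$ for complex exponents. The $q$-shifted factorial is $(A;q)_{0}=1$, $(A;q)_{k}=\prod_{r=0}^{k-1}(1-Aq^{r})$ for $k\ge1$ (similarly with base $p$). The $q$-difference operator in a variable $x$ is $\mathbb{D}_{x,q}f(x)=\dfrac{f(x)-f(qx)}{(1-q)x}$, $x\ne0$ (other variables fixed); $\mathbb{D}_{y,p}$ is the analogue in $y$ with base $p$. Notation such as $y\mathbb{D}_{y,p}\Psi_1(qx,y)$ means: apply $y\mathbb{D}_{y,p}$ to the function $y\mapsto\Psi_1(qx,y)$; $x\mathbb{D}_{x,q}\Psi_1(x,qy)$ means: apply $x\mathbb{D}_{x,q}$ to $x\mapsto\Psi_1(x,qy)$. The derivative with respect to a parameter is the same operator applied in the variable $q^a$ (resp. $p^b$): if $F$ depends on $a$ through $q^{a}$, $\mathbb{D}_{a,q}F=\dfrac{F|_{q^{a}}-F|_{q^{a+1}}}{(1-q)q^{a}}$, and if $F$ depends on $b$ through $p^b$, $\mathbb{D}_{b,p}F=\dfrac{F|_{p^{b}}-F|_{p^{b+1}}}{(1-p)p^{b}}$; similarly for the other parameters. The bibasic Humbert functions are, for $|x|,|y|<1$ and whenever no denominator factor vanishes, $$\Psi_{1}(q^{a},p^{b};p^{c},q^{d};q,p,x,y)=\sum_{\ell,k=0}^{\infty}\frac{(q^{a};q)_{k+\ell}(p^{b};p)_{\ell}}{(p^{c};p)_{\ell}(q^{d};q)_{k}(q;q)_{k}(p;p)_{\ell}}x^{k}y^{\ell},$$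 $$\Psi_{2}(q^{a};p^{b},q^{c};q,p,x,y)=\sum_{\ell,k=0}^{\infty}\frac{(q^{a};q)_{k+\ell}}{(p^{b};p)_{\ell}(q^{c};q)_{k}(q;q)_{k}(p;p)_{\ell}}x^{k}y^{\ell}.$$ *)

(* Defs.v *)
From Stdlib Require Import Reals.
From Coquelicot Require Import Coquelicot.

Open Scope R_scope.
Open Scope C_scope.

Definition Cexp (z : C) : C :=
  ((exp (Re z) * cos (Im z))%R, (exp (Re z) * sin (Im z))%R).

(* [bpow lq a] is q^a = e^{a log q}, where [lq] is the chosen value of log q,
   i.e. a complex number such that [Cexp lq = q]. *)
Definition bpow (lq a : C) : C := Cexp (a * lq).

(* (A;q)_k = (1 - A) (1 - A q) ... (1 - A q^(k-1)) *)
Fixpoint qpoch (A q : C) (k : nat) : C :=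
  match k with
  | O => 1
  | S r => qpoch A q r * (1 - A * q ^ r)
  end.

(* The rectangular partial sums over l <= L, k <= K tend to s as L and K tend
   to infinity independently. *)
Definition is_double_series (u : nat -> nat -> C) (s : C) : Prop :=
  filterlim
    (fun LK : nat * nat =>
       sum_n (fun l => sum_n (fun k => u l k) (snd LK)) (fst LK))
    (filter_prod eventually eventually) (locally s).

(* Like [RInt], this is total: the value is meaningful only if the double
   series converges. *)
Definition double_series (u : nat -> nat -> C) : C :=
  @iota C_CompleteNormedModule (is_double_series u).

(* As in the usual notation, the parameters of [Psi1] and [Psi2] are the
   powers q^a, p^b, ... themselves, not the exponents. *)
Definition Psi1 (qa pb pc qd q p x y : C) : C :=
  double_series (fun l k =>
    qpoch qa q (k + l) * qpoch pb p l
    / (qpoch pc p l * qpoch qd q k * qpoch q q k * qpoch p p l)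
    * x ^ k * y ^ l).

Definition Psi2 (qa pb qc q p x y : C) : C :=
  double_series (fun l k =>
    qpoch qa q (k + l)
    / (qpoch pb p l * qpoch qc q k * qpoch q q k * qpoch p p l)
    * x ^ k * y ^ l).

(* q-difference operator in a variable, meant for x <> 0. *)
Definition Dq (q : C) (f : C -> C) (x : C) : C :=
  (f x - f (q * x)) / ((1 - q) * x).

(* q-derivative with respect to an exponent a of a quantity that depends on a
   through q^a; [F] is that quantity as a function of q^a. *)
Definition Dqpar (q lq : C) (F : C -> C) (a : C) : C :=
  (F (bpow lq a) - F (bpow lq (a + 1))) / ((1 - q) * bpow lq a).

(* Main.v *)
(* Both functions are double power series whose coefficients are bounded: (A;q)_n
   is bounded, and bounded away from 0 when no factor vanishes.  Hence they
   converge absolutely on the open bidisc and may be combined termwise; replacing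
   x by qx and y by py multiplies the (l, k) coefficient by q^k and p^l.  Every formula
   then reduces to the effect of the shift A -> Aq on one coefficient, which
   comes from (A;q)_n (1 - A q^n) = (1 - A) (Aq;q)_n. *)

Require Import Defs.
From Stdlib Require Import Reals Lra Lia.
From Coquelicot Require Import Coquelicot.

Open Scope R_scope.
Open Scope C_scope.

(** * Geometric bounds for sums of complex terms *)

Lemma one_minus_neq_0 (z : C) : z <> 1 -> 1 - z <> 0.
Proof.
  intros hz h; apply hz.
  replace z with (1 - (1 - z)) by ring.
  rewrite h; ring.
Qed.

Lemma Cmod_lt_1_neq_1 (z : C) : (Cmod z < 1)%R -> z <> 1.
Proof. intros hz ->; rewrite Cmod_1 in hz; lra. Qed.

Lemma pow_le_1 (r : R) (n : nat) : (0 <= r <= 1 -> 0 <= r ^ n <= 1)%R.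
Proof.
  intros hr; split; [apply pow_le; lra|].
  rewrite <- (pow1 n); apply pow_incr; lra.
Qed.

Lemma geometric_tail_le (g : nat -> C) (B t : R) (N L : nat) :
  (0 <= t < 1)%R -> (forall n, (Cmod (g n) <= B * t ^ n)%R) -> (N <= L)%nat ->
  (Cmod (sum_n g L - sum_n g N) <= B * t ^ N / (1 - t))%R.
Proof.
  intros ht hg hNL.
  assert (hB : (0 <= B)%R).
  { generalize (hg O) (Cmod_ge_0 (g O)); simpl; lra. }
  (* The bound B (t^N - t^L) / (1 - t) grows by exactly B t^L from L to L + 1, which covers the
     added term, of size at most B t^(L+1). *)
  assert (H : (Cmod (sum_n g L - sum_n g N) <= B * (t ^ N - t ^ L) / (1 - t))%R).
  { induction hNL as [|L hNL IH].
    - replace (sum_n g N - sum_n g N) with (RtoC 0) by ring.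
      rewrite Cmod_0; right; field; lra.
    - rewrite sum_Sn; change plus with Cplus.
      replace (sum_n g L + g (S L) - sum_n g N)
        with ((sum_n g L - sum_n g N) + g (S L)) by ring.
      eapply Rle_trans; [apply Cmod_triangle|].
      replace (B * (t ^ N - t ^ S L) / (1 - t))%R
        with (B * (t ^ N - t ^ L) / (1 - t) + B * t ^ L)%R
        by (simpl; field; lra).
      apply Rplus_le_compat; [exact IH|].
      eapply Rle_trans; [apply hg|].
      apply Rmult_le_compat_l; [exact hB|].
      simpl; generalize (pow_le t L (proj1 ht)); nra. }
  eapply Rle_trans; [exact H|].
  unfold Rdiv; apply Rmult_le_compat_r.
  - left; apply Rinv_0_lt_compat; lra.
  - generalize (pow_le t L (proj1 ht)); nra.
Qed.

(** The term [g O] and the tail after it are each at most B / (1 - t), hence the factor 2. *)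
Lemma geometric_sum_le (g : nat -> C) (B t : R) (L : nat) :
  (0 <= t < 1)%R -> (forall n, (Cmod (g n) <= B * t ^ n)%R) ->
  (Cmod (sum_n g L) <= 2 * B / (1 - t))%R.
Proof.
  intros ht hg.
  assert (hB : (Cmod (g O) <= B)%R) by (generalize (hg O); simpl; lra).
  generalize (Cmod_ge_0 (g O)); intros h0.
  replace (sum_n g L) with ((sum_n g L - sum_n g O) + g O)
    by (rewrite sum_O; ring).
  eapply Rle_trans; [apply Cmod_triangle|].
  assert (h1 := geometric_tail_le g B t 0 L ht hg (Nat.le_0_l L)).
  simpl in h1.
  assert (B <= B / (1 - t))%R.
  { apply Rmult_le_reg_r with (1 - t)%R; [lra|].
    unfold Rdiv; rewrite Rmult_assoc, Rinv_l by lra; nra. }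
  unfold Rdiv in *; lra.
Qed.

(** * Convergence and uniqueness of double sums *)

Definition bounded2 (c : nat -> nat -> C) : Prop :=
  exists M, forall l k, (Cmod (c l k) <= M)%R.

Definition psum (u : nat -> nat -> C) (L K : nat) : C :=
  sum_n (fun l => sum_n (fun k => u l k) K) L.

(** One index moves at a time, from (N, N) to (N, K) and then to (L, K). Each move is a geometric
    tail whose terms are inner sums, themselves bounded by a geometric sum; the move in K first
    exchanges the order of summation. *)
Lemma psum_cauchy (u : nat -> nat -> C) (M s r : R) (N L K : nat) :
  (0 <= s < 1)%R -> (0 <= r < 1)%R ->
  (forall l k, (Cmod (u l k) <= M * s ^ l * r ^ k)%R) ->
  (N <= L)%nat -> (N <= K)%nat ->
  (Cmod (psum u L K - psum u N N)
   <= 2 * M / (1 - r) / (1 - s) * (s ^ N + r ^ N))%R.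
Proof.
  intros hs hr hu hL hK.
  assert (h1 : (Cmod (psum u L K - psum u N K)
                <= 2 * M / (1 - r) * s ^ N / (1 - s))%R).
  { apply geometric_tail_le; [exact hs| |exact hL].
    intros l.
    replace (2 * M / (1 - r) * s ^ l)%R with (2 * (M * s ^ l) / (1 - r))%R
      by (field; lra).
    apply geometric_sum_le; [exact hr|]; intros k; apply hu. }
  assert (h2 : (Cmod (psum u N K - psum u N N)
                <= 2 * M / (1 - s) * r ^ N / (1 - r))%R).
  { unfold psum; rewrite 2!(sum_n_switch u).
    apply geometric_tail_le; [exact hr| |exact hK].
    intros k.
    replace (2 * M / (1 - s) * r ^ k)%R with (2 * (M * r ^ k) / (1 - s))%R
      by (field; lra).
    apply geometric_sum_le; [exact hs|]; intros l.
    eapply Rle_trans; [apply hu|]; right; ring. }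
  replace (psum u L K - psum u N N)
    with ((psum u L K - psum u N K) + (psum u N K - psum u N N)) by ring.
  eapply Rle_trans; [apply Cmod_triangle|].
  replace (2 * M / (1 - r) / (1 - s) * (s ^ N + r ^ N))%R with
    (2 * M / (1 - r) * s ^ N / (1 - s) + 2 * M / (1 - s) * r ^ N / (1 - r))%R
    by (field; lra).
  lra.
Qed.

(** Limits in [C] along a proper filter are unique, so the [iota] in [double_series] returns any
    limit already found. *)
Lemma is_double_series_unique (u : nat -> nat -> C) (s : C) :
  is_double_series u s -> double_series u = s.
Proof.
  intros h.
  apply (@iota_filterlim_locally _ C_CompleteNormedModule); [|exact h].
  apply filter_prod_proper'; apply Proper_StrongProper, eventually_filter.
Qed.

(** Domination by a product of geometric sequences makes the rectangular sums Cauchy, and [C] is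
    complete. *)
Lemma ex_double_series (u : nat -> nat -> C) (M s r : R) :
  (0 <= s < 1)%R -> (0 <= r < 1)%R ->
  (forall l k, (Cmod (u l k) <= M * s ^ l * r ^ k)%R) ->
  is_double_series u (double_series u).
Proof.
  intros hs hr hu.
  assert (H : exists z, is_double_series u z).
  { apply (@filterlim_locally_cauchy (nat * nat) C_CompleteNormedModule
             (filter_prod eventually eventually) _
             (fun LK => psum u (fst LK) (snd LK))).
    intros eps.
    set (B := (2 * M / (1 - r) / (1 - s))%R).
    assert (hB : (0 <= B)%R).
    { unfold B, Rdiv.
      assert (0 <= M)%R.
      { generalize (hu O O) (Cmod_ge_0 (u O O)); simpl; lra. }
      assert (0 < / (1 - r))%R by (apply Rinv_0_lt_compat; lra).
      assert (0 < / (1 - s))%R by (apply Rinv_0_lt_compat; lra).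
      repeat apply Rmult_le_pos; lra. }
    (* B may be 0, so B + 1 is used as the divisor. Making s^N and r^N both smaller than this value
       gives B (s^N + r^N) < eps / 2, and two rectangular sums are compared through [psum u N N] at
       a cost of eps / 2 each. *)
    assert (he : (0 < eps / (4 * (B + 1)))%R).
    { apply Rdiv_lt_0_compat; [apply cond_pos|lra]. }
    destruct (pow_lt_1_zero s) with (y := (eps / (4 * (B + 1)))%R) as [N1 h1];
      [rewrite Rabs_pos_eq; lra|exact he|].
    destruct (pow_lt_1_zero r) with (y := (eps / (4 * (B + 1)))%R) as [N2 h2];
      [rewrite Rabs_pos_eq; lra|exact he|].
    set (N := (N1 + N2)%nat).
    assert (hN : (B * (s ^ N + r ^ N) < eps / 2)%R).
    { assert (k1 : (s ^ N < eps / (4 * (B + 1)))%R)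
        by (eapply Rle_lt_trans; [apply Rle_abs|apply h1; unfold N; lia]).
      assert (k2 : (r ^ N < eps / (4 * (B + 1)))%R)
        by (eapply Rle_lt_trans; [apply Rle_abs|apply h2; unfold N; lia]).
      assert (0 <= s ^ N)%R by (apply pow_le; lra).
      assert (0 <= r ^ N)%R by (apply pow_le; lra).
      assert (k3 : ((B + 1) * (eps / (4 * (B + 1))) = eps / 4)%R)
        by (field; lra).
      nra. }
    exists (fun LK => (N <= fst LK)%nat /\ (N <= snd LK)%nat); split.
    { apply Filter_prod with (fun n => (N <= n)%nat) (fun n => (N <= n)%nat).
      - exists N; auto.
      - exists N; auto.
      - auto. }
    intros [L K] [L' K'] [hL hK] [hL' hK']; simpl in *.
    apply (@norm_compat1 _ C_NormedModule).
    change (Cmod (psum u L' K' - psum u L K) < eps)%R.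
    replace (psum u L' K' - psum u L K)
      with ((psum u L' K' - psum u N N) + - (psum u L K - psum u N N)) by ring.
    eapply Rle_lt_trans; [apply Cmod_triangle|].
    rewrite Cmod_opp.
    assert (k1 := psum_cauchy u M s r N L K hs hr hu hL hK).
    assert (k2 := psum_cauchy u M s r N L' K' hs hr hu hL' hK').
    fold B in k1, k2; lra. }
  destruct H as [z hz].
  rewrite (is_double_series_unique u z hz); exact hz.
Qed.

(** * Linearity of double sums *)

Lemma is_double_series_ext (u v : nat -> nat -> C) (s : C) :
  (forall l k, u l k = v l k) -> is_double_series u s -> is_double_series v s.
Proof.
  intros huv; apply filterlim_ext; intros [L K]; simpl.
  apply sum_n_ext; intros l; apply sum_n_ext; intros k; apply huv.
Qed.

Lemma is_double_series_plus (u v : nat -> nat -> C) (s t : C) :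
  is_double_series u s -> is_double_series v t ->
  is_double_series (fun l k => u l k + v l k) (s + t).
Proof.
  intros hu hv.
  apply filterlim_ext with
    (fun LK => psum u (fst LK) (snd LK) + psum v (fst LK) (snd LK)).
  { intros [L K]; unfold psum; simpl.
    rewrite <- (sum_n_plus (G := C_AbelianMonoid)).
    apply sum_n_ext; intros l; symmetry.
    apply (sum_n_plus (G := C_AbelianMonoid)). }
  eapply filterlim_comp_2; [exact hu|exact hv|].
  apply (@filterlim_plus _ C_NormedModule).
Qed.

Lemma is_double_series_scal (a : C) (u : nat -> nat -> C) (s : C) :
  is_double_series u s -> is_double_series (fun l k => a * u l k) (a * s).
Proof.
  intros hu.
  apply filterlim_ext with (fun LK => a * psum u (fst LK) (snd LK)).
  { intros [L K]; unfold psum; simpl.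
    rewrite <- (sum_n_mult_l (K := C_Ring)).
    apply sum_n_ext; intros l; symmetry.
    apply (sum_n_mult_l (K := C_Ring)). }
  eapply filterlim_comp; [exact hu|].
  apply (@filterlim_scal_r _ C_NormedModule).
Qed.

Lemma is_double_series_minus (u v : nat -> nat -> C) (s t : C) :
  is_double_series u s -> is_double_series v t ->
  is_double_series (fun l k => u l k - v l k) (s - t).
Proof.
  intros hu hv.
  replace (s - t) with (s + -(1) * t) by ring.
  eapply is_double_series_ext;
    [|apply is_double_series_plus;
       [exact hu|apply is_double_series_scal, hv]].
  intros l k; simpl; ring.
Qed.

(** * Double power series with bounded coefficients *)

Definition dpseries (c : nat -> nat -> C) (x y : C) : C :=
  double_series (fun l k => c l k * x ^ k * y ^ l).

Lemma is_dpseries (c : nat -> nat -> C) (x y : C) :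
  bounded2 c -> (Cmod x < 1)%R -> (Cmod y < 1)%R ->
  is_double_series (fun l k => c l k * x ^ k * y ^ l) (dpseries c x y).
Proof.
  intros [M hM] hx hy.
  apply ex_double_series with M (Cmod y) (Cmod x).
  - split; [apply Cmod_ge_0|exact hy].
  - split; [apply Cmod_ge_0|exact hx].
  - intros l k; rewrite !Cmod_mult, !Cmod_pow.
    replace (M * Cmod y ^ l * Cmod x ^ k)%R
      with (M * Cmod x ^ k * Cmod y ^ l)%R by ring.
    repeat apply Rmult_le_compat_r;
      try (apply pow_le; apply Cmod_ge_0); apply hM.
Qed.

(** Identities between values are proved this way: each side is exhibited as the limit of a series,
    and the terms are compared. *)
Lemma is_double_series_eq (u v : nat -> nat -> C) (s t : C) :
  is_double_series u s -> is_double_series v t ->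
  (forall l k, u l k = v l k) -> s = t.
Proof.
  intros hu hv h.
  rewrite <- (is_double_series_unique v t hv).
  symmetry; apply is_double_series_unique.
  exact (is_double_series_ext u v s h hu).
Qed.

(** * Difference operators acting on double power series *)

Section Difference.

Variables (q p x y : C).
Hypotheses (hq : (Cmod q < 1)%R) (hp : (Cmod p < 1)%R).
Hypotheses (hx0 : x <> 0) (hx : (Cmod x < 1)%R).
Hypotheses (hy0 : y <> 0) (hy : (Cmod y < 1)%R).

Lemma Cmod_mult_lt_1 (a b : C) :
  (Cmod a < 1)%R -> (Cmod b < 1)%R -> (Cmod (a * b) < 1)%R.
Proof.
  intros ha hb; rewrite Cmod_mult.
  generalize (Cmod_ge_0 a) (Cmod_ge_0 b); nra.
Qed.

Lemma one_minus_base_neq_0 (r : C) : (Cmod r < 1)%R -> 1 - r <> 0.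
Proof. intros hr; apply one_minus_neq_0, Cmod_lt_1_neq_1, hr. Qed.

Lemma mult_Dq (f : C -> C) (r z : C) :
  (Cmod r < 1)%R -> z <> 0 -> z * Dq r f z = (f z - f (r * z)) / (1 - r).
Proof.
  intros hr hz; unfold Dq.
  assert (hr1 := one_minus_base_neq_0 r hr).
  field; auto.
Qed.

(** Here [c] and [c'] are the coefficients at a parameter and at its shift, [g] those of the series
    on the right. The parameter is [w], which also divides in [Dqpar], and [e] is the prefactor, 1 /
    (1 - w) up to sign in the applications. *)
Variables (c c' g : nat -> nat -> C) (w e : C).
Hypotheses (hc : bounded2 c) (hc' : bounded2 c') (hg : bounded2 g).
Hypothesis (hw : w <> 0).

Ltac dps h :=
  apply is_dpseries; [exact h|..]; repeat apply Cmod_mult_lt_1; assumption.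

(** Replacing x by q x multiplies the (l, k) term by q^k, so the factor 1 - q^k is what [x * Dq q]
    produces, up to 1 - q; the factor w cancels the w in the denominator. *)
Lemma dpseries_diff_x :
  (forall l k, c l k - c' l k = w * e * (1 - q ^ k) * g l k) ->
  (dpseries c x y - dpseries c' x y) / ((1 - q) * w)
  = e * (x * Dq q (fun x' => dpseries g x' y) x).
Proof.
  intros h; rewrite mult_Dq by assumption.
  assert (hq1 := one_minus_base_neq_0 q hq).
  assert (H : dpseries c x y - dpseries c' x y
              = w * e * (dpseries g x y - dpseries g (q * x) y)).
  { eapply is_double_series_eq.
    - apply is_double_series_minus; [dps hc|dps hc'].
    - apply is_double_series_scal, is_double_series_minus; dps hg.
    - intros l k; simpl; rewrite Cpow_mult_l.
      replace (c l k) with (c' l k + w * e * (1 - q ^ k) * g l k)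
        by (rewrite <- h; ring).
      ring. }
  rewrite H; field; auto.
Qed.

Lemma dpseries_diff_y :
  (forall l k, c l k - c' l k = w * e * (1 - p ^ l) * g l k) ->
  (dpseries c x y - dpseries c' x y) / ((1 - p) * w)
  = e * (y * Dq p (fun y' => dpseries g x y') y).
Proof.
  intros h; rewrite mult_Dq by assumption.
  assert (hp1 := one_minus_base_neq_0 p hp).
  assert (H : dpseries c x y - dpseries c' x y
              = w * e * (dpseries g x y - dpseries g x (p * y))).
  { eapply is_double_series_eq.
    - apply is_double_series_minus; [dps hc|dps hc'].
    - apply is_double_series_scal, is_double_series_minus; dps hg.
    - intros l k; simpl; rewrite Cpow_mult_l.
      replace (c l k) with (c' l k + w * e * (1 - p ^ l) * g l k)
        by (rewrite <- h; ring).
      ring. }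
  rewrite H; field; auto.
Qed.

(** Since q^(k+l) = q^k q^l, the factor 1 - q^(k+l) arises from scaling both variables by q, even y,
    whose own base is p. *)
Lemma dpseries_diff_xy :
  (forall l k, c l k - c' l k = w * e * (1 - q ^ (k + l)) * c l k) ->
  (dpseries c x y - dpseries c' x y) / ((1 - q) * w)
  = e * ((dpseries c x y - dpseries c (q * x) (q * y)) / (1 - q)).
Proof.
  intros h.
  assert (hq1 := one_minus_base_neq_0 q hq).
  assert (H : dpseries c x y - dpseries c' x y
              = w * e * (dpseries c x y - dpseries c (q * x) (q * y))).
  { eapply is_double_series_eq.
    - apply is_double_series_minus; [dps hc|dps hc'].
    - apply is_double_series_scal, is_double_series_minus; dps hc.
    - intros l k; simpl; rewrite !Cpow_mult_l.
      transitivity ((c l k - c' l k) * x ^ k * y ^ l); [ring|].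
      rewrite h, Cpow_add_r; ring. }
  rewrite H; field; auto.
Qed.

(* Both right-hand sides telescope to [dpseries c x y - dpseries c (q x) (q y)],
   which is why the values at [p y] cancel although [p] and [q] are unrelated. *)
Lemma dpseries_diff_xy_x_first :
  (forall l k, c l k - c' l k = w * e * (1 - q ^ (k + l)) * c l k) ->
  (dpseries c x y - dpseries c' x y) / ((1 - q) * w)
  = e * (x * Dq q (fun x' => dpseries c x' y) x
         + (1 - p) / (1 - q) * (y * Dq p (fun y' => dpseries c (q * x) y') y)
         + 1 / (1 - q) * dpseries c (q * x) (p * y)
         - 1 / (1 - q) * dpseries c (q * x) (q * y)).
Proof.
  intros h; rewrite (dpseries_diff_xy h), !mult_Dq by assumption.
  assert (hq1 := one_minus_base_neq_0 q hq).
  assert (hp1 := one_minus_base_neq_0 p hp).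
  field; auto.
Qed.

(** The path from (x, y) to (q x, q y) now goes through (x, q y) instead of (q x, y). *)
Lemma dpseries_diff_xy_y_first :
  (forall l k, c l k - c' l k = w * e * (1 - q ^ (k + l)) * c l k) ->
  (dpseries c x y - dpseries c' x y) / ((1 - q) * w)
  = e * ((1 - p) / (1 - q) * (y * Dq p (fun y' => dpseries c x y') y)
         + x * Dq q (fun x' => dpseries c x' (q * y)) x
         + 1 / (1 - q) * dpseries c x (p * y)
         - 1 / (1 - q) * dpseries c x (q * y)).
Proof.
  intros h; rewrite (dpseries_diff_xy h), !mult_Dq by assumption.
  assert (hq1 := one_minus_base_neq_0 q hq).
  assert (hp1 := one_minus_base_neq_0 p hp).
  field; auto.
Qed.

End Difference.

(** * Parameter shifts in the q-shifted factorial *)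

Lemma qpoch_S_l (A q : C) (n : nat) :
  qpoch A q (S n) = (1 - A) * qpoch (A * q) q n.
Proof.
  induction n as [|n IH]; [simpl; ring|].
  change (qpoch A q (S (S n))) with (qpoch A q (S n) * (1 - A * q ^ S n)).
  rewrite IH, Cpow_S; simpl; ring.
Qed.

(** Both sides are [qpoch A q (S n)], with the last factor split off on the left and the first one
    on the right. *)
Lemma qpoch_shift (A q : C) (n : nat) :
  qpoch A q n * (1 - A * q ^ n) = (1 - A) * qpoch (A * q) q n.
Proof. exact (qpoch_S_l A q n). Qed.

(** Case of a numerator parameter: 1 - (1 - A q^n) / (1 - A) = - A (1 - q^n) / (1 - A), and the
    unshifted factorial remains. *)
Lemma qpoch_sub_shift (A q : C) (n : nat) :
  A <> 1 ->
  qpoch A q n - qpoch (A * q) q n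
  = A * - (1 / (1 - A)) * (1 - q ^ n) * qpoch A q n.
Proof.
  intros hA.
  assert (hA1 := one_minus_neq_0 A hA).
  replace (qpoch (A * q) q n) with (qpoch A q n * (1 - A * q ^ n) / (1 - A))
    by (rewrite qpoch_shift; field; exact hA1).
  field; exact hA1.
Qed.

Lemma qpoch_neq_0 (A q : C) :
  (forall n, A * q ^ n <> 1) -> forall n, qpoch A q n <> 0.
Proof.
  intros h; induction n as [|n IH]; simpl.
  - intros e; apply RtoC_inj in e; lra.
  - apply Cmult_neq_0; [exact IH|apply one_minus_neq_0, h].
Qed.

Lemma shift_neq_1 (A q : C) :
  (forall n, A * q ^ n <> 1) -> forall n, A * q * q ^ n <> 1.
Proof.
  intros h n; rewrite <- Cmult_assoc, <- Cpow_S; apply h.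
Qed.

(** Case of a denominator parameter: (1 - A q^n) / (1 - A) - 1 = A (1 - q^n) / (1 - A). The sign is
    opposite and the shifted factorial remains, which is why the formulas for denominator parameters
    have a shifted function on the right. *)
Lemma qpoch_inv_sub_shift (A q : C) (n : nat) :
  (forall m, A * q ^ m <> 1) ->
  / qpoch A q n - / qpoch (A * q) q n
  = A * (1 / (1 - A)) * (1 - q ^ n) * / qpoch (A * q) q n.
Proof.
  intros h.
  assert (h1 := qpoch_neq_0 A q h n).
  assert (h2 := qpoch_neq_0 (A * q) q (shift_neq_1 A q h) n).
  assert (hA1 : 1 - A <> 0).
  { apply one_minus_neq_0; generalize (h O); simpl; rewrite Cmult_1_r; auto. }
  assert (hn : 1 - A * q ^ n <> 0) by apply one_minus_neq_0, h.
  replace (/ qpoch A q n) with ((1 - A * q ^ n) / ((1 - A) * qpoch (A * q) q n)).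
  2: { rewrite <- qpoch_shift; field; auto. }
  field; auto.
Qed.

(** * Upper and lower bounds for q-shifted factorials *)

Definition bounded (f : nat -> C) : Prop :=
  exists M, forall n, (Cmod (f n) <= M)%R.

(** Each factor satisfies |1 - A q^r| <= 1 + |A| |q|^r <= exp (|A| |q|^r), and the exponents add up
    to a partial geometric sum. *)
Lemma qpoch_bounded (A q : C) : (Cmod q < 1)%R -> bounded (qpoch A q).
Proof.
  intros hq.
  assert (h0 := Cmod_ge_0 q); assert (hA := Cmod_ge_0 A).
  assert (H : forall n, (Cmod (qpoch A q n)
                <= exp (Cmod A * (1 - Cmod q ^ n) / (1 - Cmod q)))%R).
  { induction n as [|n IH].
    - simpl; rewrite Cmod_1, Rminus_diag, Rmult_0_r.
      unfold Rdiv; rewrite Rmult_0_l, exp_0; lra.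
    - replace (Cmod A * (1 - Cmod q ^ S n) / (1 - Cmod q))%R
        with (Cmod A * (1 - Cmod q ^ n) / (1 - Cmod q) + Cmod A * Cmod q ^ n)%R
        by (simpl; field; lra).
      simpl; rewrite Cmod_mult, exp_plus.
      apply Rmult_le_compat; try apply Cmod_ge_0; [exact IH|].
      unfold Cminus; eapply Rle_trans; [apply Cmod_triangle|].
      rewrite Cmod_opp, Cmod_1, Cmod_mult, Cmod_pow.
      apply exp_ineq1_le. }
  exists (exp (Cmod A / (1 - Cmod q))); intros n.
  eapply Rle_trans; [apply H|].
  assert (exp_mono : forall s t, (s <= t -> exp s <= exp t)%R).
  { intros s t [hst| ->]; [left; apply exp_increasing, hst|right; reflexivity]. }
  apply exp_mono; unfold Rdiv; apply Rmult_le_compat_r.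
  - left; apply Rinv_0_lt_compat; lra.
  - generalize (pow_le (Cmod q) n h0); nra.
Qed.

(* Weierstrass: prod (1 - a_r) >= 1 - sum a_r when the a_r lie in [0, 1]. *)
Lemma qpoch_ge_weierstrass (A q : C) :
  (Cmod q < 1)%R -> (Cmod A <= (1 - Cmod q) / 2)%R ->
  forall n, (1 / 2 <= Cmod (qpoch A q n))%R.
Proof.
  intros hq hA n.
  assert (h0 := Cmod_ge_0 q); assert (hA0 := Cmod_ge_0 A).
  assert (H : (1 - Cmod A * (1 - Cmod q ^ n) / (1 - Cmod q)
               <= Cmod (qpoch A q n))%R).
  { induction n as [|n IH].
    - simpl; rewrite Cmod_1, Rminus_diag, Rmult_0_r.
      unfold Rdiv; rewrite Rmult_0_l; lra.
    - replace (Cmod A * (1 - Cmod q ^ S n) / (1 - Cmod q))%R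
        with (Cmod A * (1 - Cmod q ^ n) / (1 - Cmod q) + Cmod A * Cmod q ^ n)%R
        by (simpl; field; lra).
      assert (hp := pow_le_1 (Cmod q) n ltac:(lra)).
      set (S := (Cmod A * (1 - Cmod q ^ n) / (1 - Cmod q))%R) in *.
      assert (hS : (0 <= S)%R).
      { unfold S, Rdiv; repeat apply Rmult_le_pos; try lra.
        left; apply Rinv_0_lt_compat; lra. }
      assert (hf : (1 - Cmod A * Cmod q ^ n <= Cmod (1 - A * q ^ n))%R).
      { rewrite <- Cmod_pow, <- Cmod_mult.
        assert (h1 := Cmod_triangle (1 - A * q ^ n) (A * q ^ n)).
        replace (1 - A * q ^ n + A * q ^ n) with (RtoC 1) in h1 by ring.
        rewrite Cmod_1 in h1; lra. }
      simpl; rewrite Cmod_mult.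
      set (t := (Cmod A * Cmod q ^ n)%R) in *.
      assert (ht : (0 <= t <= 1)%R) by (unfold t; split; nra).
      (* As S and t are nonnegative, (1 - S)(1 - t) >= 1 - S - t; the bound t <= 1 allows the
         induction hypothesis to be multiplied by 1 - t. *)
      apply Rle_trans with (Cmod (qpoch A q n) * (1 - t))%R; [nra|].
      apply Rmult_le_compat_l; [apply Cmod_ge_0|exact hf]. }
  assert (hp := pow_le_1 (Cmod q) n ltac:(lra)).
  (* The threshold (1 - |q|) / 2 on |A| keeps the whole geometric sum below 1/2. *)
  assert (Cmod A * (1 - Cmod q ^ n) / (1 - Cmod q) <= 1 / 2)%R.
  { apply Rmult_le_reg_r with (1 - Cmod q)%R; [lra|].
    unfold Rdiv at 1; rewrite Rmult_assoc, Rinv_l by lra; nra. }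
  lra.
Qed.

(** For some N the shifted parameter A q^N is small enough for the Weierstrass bound. Induction on
    N, with A general, peels off the first factor 1 - A, which is nonzero, and passes to A q. *)
Lemma qpoch_bounded_below (A q : C) :
  (Cmod q < 1)%R -> (forall n, A * q ^ n <> 1) ->
  exists m, (0 < m)%R /\ forall n, (m <= Cmod (qpoch A q n))%R.
Proof.
  intros hq h.
  assert (h0 := Cmod_ge_0 q); assert (hA0 := Cmod_ge_0 A).
  assert (HN : exists N, (Cmod A * Cmod q ^ N <= (1 - Cmod q) / 2)%R).
  { destruct (pow_lt_1_zero (Cmod q))
      with (y := ((1 - Cmod q) / 2 / (Cmod A + 1))%R) as [N hN].
    - rewrite Rabs_pos_eq; lra.
    - repeat apply Rdiv_lt_0_compat; lra.
    - exists N.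
      specialize (hN N (Nat.le_refl N)).
      rewrite Rabs_pos_eq in hN by (apply pow_le; lra).
      assert (hp := pow_le (Cmod q) N h0).
      assert (E : ((Cmod A + 1) * ((1 - Cmod q) / 2 / (Cmod A + 1))
                   = (1 - Cmod q) / 2)%R) by (field; lra).
      nra. }
  destruct HN as [N hN]; revert A h hA0 hN.
  induction N as [|N IH]; intros A h hA0 hN.
  - exists (1 / 2)%R; split; [lra|].
    apply qpoch_ge_weierstrass; [exact hq|simpl in hN; lra].
  - destruct (IH (A * q)) as [m [hm hm']].
    + exact (shift_neq_1 A q h).
    + apply Cmod_ge_0.
    + rewrite Cmod_mult; simpl in hN; lra.
    + assert (hA1 : (0 < Cmod (1 - A))%R).
      { apply Cmod_gt_0, one_minus_neq_0.
        generalize (h O); simpl; rewrite Cmult_1_r; auto. }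
      (* The 1 accounts for n = 0, where the product is empty. *)
      exists (Rmin 1 (Cmod (1 - A) * m)); split.
      { apply Rmin_glb_lt; nra. }
      intros [|n].
      * simpl; rewrite Cmod_1; apply Rmin_l.
      * rewrite qpoch_S_l, Cmod_mult.
        eapply Rle_trans; [apply Rmin_r|].
        apply Rmult_le_compat_l; [lra|apply hm'].
Qed.

Lemma qpoch_inv_bounded (A q : C) :
  (Cmod q < 1)%R -> (forall n, A * q ^ n <> 1) ->
  bounded (fun n => / qpoch A q n).
Proof.
  intros hq h.
  destruct (qpoch_bounded_below A q hq h) as [m [hm hm']].
  exists (/ m)%R; intros n.
  rewrite Cmod_inv by apply qpoch_neq_0, h.
  apply Rinv_le_contravar; [exact hm|apply hm'].
Qed.

(** * Coefficients of the two Humbert functions *)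

Lemma bounded2_mult (f g : nat -> nat -> C) :
  bounded2 f -> bounded2 g -> bounded2 (fun l k => f l k * g l k).
Proof.
  intros [M hM] [M' hM']; exists (M * M')%R; intros l k.
  rewrite Cmod_mult; apply Rmult_le_compat; auto using Cmod_ge_0.
Qed.

Lemma bounded2_reindex (f : nat -> C) (i : nat -> nat -> nat) :
  bounded f -> bounded2 (fun l k => f (i l k)).
Proof. intros [M hM]; exists M; auto. Qed.

Lemma bounded2_ext (f g : nat -> nat -> C) :
  (forall l k, f l k = g l k) -> bounded2 f -> bounded2 g.
Proof. intros h [M hM]; exists M; intros l k; rewrite <- h; apply hM. Qed.

Lemma base_neq_1 (q : C) : (Cmod q < 1)%R -> forall n, q * q ^ n <> 1.
Proof.
  intros hq n; apply Cmod_lt_1_neq_1.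
  rewrite Cmod_mult, Cmod_pow.
  assert (h := pow_le_1 (Cmod q) n ltac:(generalize (Cmod_ge_0 q); lra)).
  generalize (Cmod_ge_0 q); nra.
Qed.

(** Written exactly as the summand of [Psi1], so that [Psi1] is convertible to [dpseries] of these
    coefficients; likewise for [psi2_coeff]. *)
Definition psi1_coeff (A B C' D q p : C) (l k : nat) : C :=
  qpoch A q (k + l) * qpoch B p l
  / (qpoch C' p l * qpoch D q k * qpoch q q k * qpoch p p l).

Definition psi2_coeff (A B C' q p : C) (l k : nat) : C :=
  qpoch A q (k + l)
  / (qpoch B p l * qpoch C' q k * qpoch q q k * qpoch p p l).

Section Coefficients.

Variables (q p : C).
Hypotheses (hq : (Cmod q < 1)%R) (hp : (Cmod p < 1)%R).

(** Kept in the context so that [auto] can discharge the conditions that [field] raises on (q;q)_k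
    and (p;p)_l. *)
Let nq := qpoch_neq_0 q q (base_neq_1 q hq).
Let np := qpoch_neq_0 p p (base_neq_1 p hp).

(** Each coefficient is a product of five bounded sequences: one factorial in k + l and four
    reciprocals in k or l. *)
Lemma psi2_coeff_bounded (A B C' : C) :
  (forall n, B * p ^ n <> 1) -> (forall n, C' * q ^ n <> 1) ->
  bounded2 (psi2_coeff A B C' q p).
Proof.
  intros hB hC.
  apply bounded2_ext with (fun l k =>
    qpoch A q (k + l) * / qpoch B p l * / qpoch C' q k
    * / qpoch q q k * / qpoch p p l).
  { intros l k; unfold psi2_coeff.
    assert (h1 := qpoch_neq_0 B p hB l).
    assert (h2 := qpoch_neq_0 C' q hC k).
    field; auto. }
  assert (iq := qpoch_inv_bounded q q hq (base_neq_1 q hq)).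
  assert (ip := qpoch_inv_bounded p p hp (base_neq_1 p hp)).
  assert (iB := qpoch_inv_bounded B p hp hB).
  assert (iC := qpoch_inv_bounded C' q hq hC).
  repeat apply bounded2_mult.
  - exact (bounded2_reindex _ (fun l k => (k + l)%nat) (qpoch_bounded A q hq)).
  - exact (bounded2_reindex _ (fun l k => l) iB).
  - exact (bounded2_reindex _ (fun l k => k) iC).
  - exact (bounded2_reindex _ (fun l k => k) iq).
  - exact (bounded2_reindex _ (fun l k => l) ip).
Qed.

(** Reduces bounds and shifts for [psi1_coeff] to those for [psi2_coeff]: the factor (B;p)_l depends
    on neither A, C' nor D. *)
Lemma psi1_coeff_psi2 (A B C' D : C) (l k : nat) :
  psi1_coeff A B C' D q p l k = qpoch B p l * psi2_coeff A C' D q p l k.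
Proof. unfold psi1_coeff, psi2_coeff, Cdiv; ring. Qed.

Lemma psi1_coeff_bounded (A B C' D : C) :
  (forall n, C' * p ^ n <> 1) -> (forall n, D * q ^ n <> 1) ->
  bounded2 (psi1_coeff A B C' D q p).
Proof.
  intros hC hD.
  eapply bounded2_ext; [intros l k; symmetry; apply psi1_coeff_psi2|].
  apply bounded2_mult; [|apply psi2_coeff_bounded; assumption].
  exact (bounded2_reindex _ (fun l k => l) (qpoch_bounded B p hp)).
Qed.

Lemma psi2_coeff_sub_a (A B C' : C) (l k : nat) :
  A <> 1 ->
  psi2_coeff A B C' q p l k - psi2_coeff (A * q) B C' q p l k
  = A * - (1 / (1 - A)) * (1 - q ^ (k + l)) * psi2_coeff A B C' q p l k.
Proof.
  intros hA; unfold psi2_coeff, Cdiv.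
  set (d := / (_ * _)).
  transitivity ((qpoch A q (k + l) - qpoch (A * q) q (k + l)) * d); [ring|].
  rewrite qpoch_sub_shift by exact hA; unfold Cdiv; ring.
Qed.

Lemma psi2_coeff_sub_b (A B C' : C) (l k : nat) :
  (forall n, B * p ^ n <> 1) -> (forall n, C' * q ^ n <> 1) ->
  psi2_coeff A B C' q p l k - psi2_coeff A (B * p) C' q p l k
  = B * (1 / (1 - B)) * (1 - p ^ l) * psi2_coeff A (B * p) C' q p l k.
Proof.
  intros hB hC; unfold psi2_coeff.
  assert (h1 := qpoch_neq_0 B p hB l).
  assert (h1' := qpoch_neq_0 (B * p) p (shift_neq_1 B p hB) l).
  assert (h2 := qpoch_neq_0 C' q hC k).
  (* Everything free of B is collected in [d], leaving a difference of reciprocals of factorials. *)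
  set (d := qpoch A q (k + l) / (qpoch C' q k * qpoch q q k * qpoch p p l)).
  transitivity ((/ qpoch B p l - / qpoch (B * p) p l) * d).
  { unfold d; field; repeat split; auto. }
  rewrite qpoch_inv_sub_shift by exact hB.
  assert (hB1 : 1 - B <> 0).
  { apply one_minus_neq_0; generalize (hB O); simpl; rewrite Cmult_1_r; auto. }
  unfold d; field; repeat split; auto.
Qed.

Lemma psi2_coeff_sub_c (A B C' : C) (l k : nat) :
  (forall n, B * p ^ n <> 1) -> (forall n, C' * q ^ n <> 1) ->
  psi2_coeff A B C' q p l k - psi2_coeff A B (C' * q) q p l k
  = C' * (1 / (1 - C')) * (1 - q ^ k) * psi2_coeff A B (C' * q) q p l k.
Proof.
  intros hB hC; unfold psi2_coeff.
  assert (h1 := qpoch_neq_0 B p hB l).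
  assert (h2 := qpoch_neq_0 C' q hC k).
  assert (h2' := qpoch_neq_0 (C' * q) q (shift_neq_1 C' q hC) k).
  set (d := qpoch A q (k + l) / (qpoch B p l * qpoch q q k * qpoch p p l)).
  transitivity ((/ qpoch C' q k - / qpoch (C' * q) q k) * d).
  { unfold d; field; repeat split; auto. }
  rewrite qpoch_inv_sub_shift by exact hC.
  assert (hC1 : 1 - C' <> 0).
  { apply one_minus_neq_0; generalize (hC O); simpl; rewrite Cmult_1_r; auto. }
  unfold d; field; repeat split; auto.
Qed.

Lemma psi1_coeff_sub_b (A B C' D : C) (l k : nat) :
  B <> 1 ->
  psi1_coeff A B C' D q p l k - psi1_coeff A (B * p) C' D q p l k
  = B * - (1 / (1 - B)) * (1 - p ^ l) * psi1_coeff A B C' D q p l k.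
Proof.
  intros hB; rewrite !psi1_coeff_psi2.
  transitivity ((qpoch B p l - qpoch (B * p) p l) * psi2_coeff A C' D q p l k);
    [ring|].
  rewrite qpoch_sub_shift by exact hB; ring.
Qed.

Lemma psi1_coeff_sub_a (A B C' D : C) (l k : nat) :
  A <> 1 ->
  psi1_coeff A B C' D q p l k - psi1_coeff (A * q) B C' D q p l k
  = A * - (1 / (1 - A)) * (1 - q ^ (k + l)) * psi1_coeff A B C' D q p l k.
Proof.
  intros hA; rewrite !psi1_coeff_psi2.
  transitivity (qpoch B p l * (psi2_coeff A C' D q p l k
                               - psi2_coeff (A * q) C' D q p l k)); [ring|].
  rewrite psi2_coeff_sub_a by exact hA; ring.
Qed.

Lemma psi1_coeff_sub_c (A B C' D : C) (l k : nat) :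
  (forall n, C' * p ^ n <> 1) -> (forall n, D * q ^ n <> 1) ->
  psi1_coeff A B C' D q p l k - psi1_coeff A B (C' * p) D q p l k
  = C' * (1 / (1 - C')) * (1 - p ^ l) * psi1_coeff A B (C' * p) D q p l k.
Proof.
  intros hC hD; rewrite !psi1_coeff_psi2.
  transitivity (qpoch B p l * (psi2_coeff A C' D q p l k
                               - psi2_coeff A (C' * p) D q p l k)); [ring|].
  rewrite psi2_coeff_sub_b by assumption; ring.
Qed.

Lemma psi1_coeff_sub_d (A B C' D : C) (l k : nat) :
  (forall n, C' * p ^ n <> 1) -> (forall n, D * q ^ n <> 1) ->
  psi1_coeff A B C' D q p l k - psi1_coeff A B C' (D * q) q p l k
  = D * (1 / (1 - D)) * (1 - q ^ k) * psi1_coeff A B C' (D * q) q p l k.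
Proof.
  intros hC hD; rewrite !psi1_coeff_psi2.
  transitivity (qpoch B p l * (psi2_coeff A C' D q p l k
                               - psi2_coeff A C' (D * q) q p l k)); [ring|].
  rewrite psi2_coeff_sub_c by assumption; ring.
Qed.

End Coefficients.

(** * Complex powers of the bases *)

Lemma Cexp_plus (z w : C) : Cexp (z + w) = Cexp z * Cexp w.
Proof.
  destruct z as [a b], w as [c d]; unfold Cexp, Cmult, Cplus; simpl.
  rewrite exp_plus, cos_plus, sin_plus; f_equal; ring.
Qed.

(** Follows from e^z e^(-z) = 1; it makes q^a and p^b legitimate denominators in the parameter
    derivatives. *)
Lemma Cexp_neq_0 (z : C) : Cexp z <> 0.
Proof.
  intros h.
  assert (h1 : Cexp (z + - z) = 0) by (rewrite Cexp_plus, h; ring).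
  replace (z + - z) with (RtoC 0) in h1 by ring.
  unfold Cexp in h1; simpl in h1.
  rewrite exp_0, cos_0 in h1; injection h1; lra.
Qed.

Lemma bpow_succ (lq q a : C) : Cexp lq = q -> bpow lq (a + 1) = bpow lq a * q.
Proof.
  intros <-; unfold bpow; rewrite <- Cexp_plus; f_equal; ring.
Qed.

(** Turns the condition on denominator parameters into the non-vanishing of the factors of
    [qpoch]. *)
Lemma neq_inv_pow (q A : C) :
  q <> 0 -> (forall n : nat, A <> / q ^ n) -> forall n : nat, A * q ^ n <> 1.
Proof.
  intros hq h n e; apply (h n).
  assert (hn := Cpow_nz q n hq).
  rewrite <- (Cmult_1_l (/ q ^ n)), <- e; field; exact hn.
Qed.

Theorem theorem2p7 :
  forall (q p lq lp x y : C),
  (0 < Cmod q < 1)%R -> (0 < Cmod p < 1)%R ->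
  Cexp lq = q -> Cexp lp = p ->
  (0 < Cmod x < 1)%R -> (0 < Cmod y < 1)%R ->
  (forall a b c d : C,
     (forall n : nat, bpow lp c <> / p ^ n) ->
     (forall n : nat, bpow lq d <> / q ^ n) ->
     let qa := bpow lq a in
     let pb := bpow lp b in
     let pc := bpow lp c in
     let qd := bpow lq d in
     let Psi := Psi1 qa pb pc qd q p in
     (qa <> 1 ->
        Dqpar q lq (fun A => Psi1 A pb pc qd q p x y) a
        = - (1 / (1 - qa))
          * (x * Dq q (fun x' => Psi x' y) x
             + (1 - p) / (1 - q) * (y * Dq p (fun y' => Psi (q * x) y') y)
             + 1 / (1 - q) * Psi (q * x) (p * y)
             - 1 / (1 - q) * Psi (q * x) (q * y))
        /\
        Dqpar q lq (fun A => Psi1 A pb pc qd q p x y) a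
        = - (1 / (1 - qa))
          * ((1 - p) / (1 - q) * (y * Dq p (fun y' => Psi x y') y)
             + x * Dq q (fun x' => Psi x' (q * y)) x
             + 1 / (1 - q) * Psi x (p * y)
             - 1 / (1 - q) * Psi x (q * y)))
     /\
     Dqpar q lq (fun D => Psi1 qa pb pc D q p x y) d
     = 1 / (1 - qd)
       * (x * Dq q (fun x' => Psi1 qa pb pc (bpow lq (d + 1)) q p x' y) x)
     /\
     (pb <> 1 ->
        Dqpar p lp (fun B => Psi1 qa B pc qd q p x y) b
        = - (1 / (1 - pb)) * (y * Dq p (fun y' => Psi x y') y))
     /\
     Dqpar p lp (fun C' => Psi1 qa pb C' qd q p x y) c
     = 1 / (1 - pc)
       * (y * Dq p (fun y' => Psi1 qa pb (bpow lp (c + 1)) qd q p x y') y))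
  /\
  (forall a b c : C,
     (forall n : nat, bpow lp b <> / p ^ n) ->
     (forall n : nat, bpow lq c <> / q ^ n) ->
     let qa := bpow lq a in
     let pb := bpow lp b in
     let qc := bpow lq c in
     let Psi := Psi2 qa pb qc q p in
     (qa <> 1 ->
        Dqpar q lq (fun A => Psi2 A pb qc q p x y) a
        = - (1 / (1 - qa))
          * (x * Dq q (fun x' => Psi x' y) x
             + (1 - p) / (1 - q) * (y * Dq p (fun y' => Psi (q * x) y') y)
             + 1 / (1 - q) * Psi (q * x) (p * y)
             - 1 / (1 - q) * Psi (q * x) (q * y))
        /\
        Dqpar q lq (fun A => Psi2 A pb qc q p x y) a
        = - (1 / (1 - qa))
          * ((1 - p) / (1 - q) * (y * Dq p (fun y' => Psi x y') y)
             + x * Dq q (fun x' => Psi x' (q * y)) x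
             + 1 / (1 - q) * Psi x (p * y)
             - 1 / (1 - q) * Psi x (q * y)))
     /\
     Dqpar q lq (fun C' => Psi2 qa pb C' q p x y) c
     = 1 / (1 - qc)
       * (x * Dq q (fun x' => Psi2 qa pb (bpow lq (c + 1)) q p x' y) x)
     /\
     Dqpar p lp (fun B => Psi2 qa B qc q p x y) b
     = 1 / (1 - pb)
       * (y * Dq p (fun y' => Psi2 qa (bpow lp (b + 1)) qc q p x y') y)).
Proof.
  intros q p lq lp x y [hq0 hq] [hp0 hp] elq elp [hx0 hx] [hy0 hy].
  apply Cmod_gt_0 in hq0; apply Cmod_gt_0 in hp0.
  apply Cmod_gt_0 in hx0; apply Cmod_gt_0 in hy0.
  split.
  - intros a b c d hc hd qa pb pc qd Psi.
    assert (hc1 := neq_inv_pow p pc hp0 hc).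
    assert (hd1 := neq_inv_pow q qd hq0 hd).
    assert (hc2 := shift_neq_1 pc p hc1); assert (hd2 := shift_neq_1 qd q hd1).
    (* Left general in the numerator parameters, so that it bounds the coefficients both before and
       after a shift of A or B. *)
    assert (hbd := fun A B => psi1_coeff_bounded q p hq hp A B pc qd hc1 hd1).
    (* Once q^(a+1) is rewritten as q^a q, in the derivatives and in the shifted functions alike,
       each goal is a difference lemma up to conversion, with the parameter as w. *)
    unfold Dqpar.
    rewrite !(bpow_succ lq q _ elq), !(bpow_succ lp p _ elp).
    split; [intros ha; split|split; [|split; [intros hb|]]].
    + exact (dpseries_diff_xy_x_first q p x y hq hp hx0 hx hy0 hy _ _ qa _
               (hbd qa pb) (hbd (qa * q) pb) (Cexp_neq_0 _)
               (fun l k => psi1_coeff_sub_a q p qa pb pc qd l k ha)).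
    + exact (dpseries_diff_xy_y_first q p x y hq hp hx0 hx hy0 hy _ _ qa _
               (hbd qa pb) (hbd (qa * q) pb) (Cexp_neq_0 _)
               (fun l k => psi1_coeff_sub_a q p qa pb pc qd l k ha)).
    (* For a denominator parameter the array [g] on the right is the shifted one, hence [hbd']
       serves twice; for the numerator parameter b it is the unshifted one. *)
    + assert (hbd' := psi1_coeff_bounded q p hq hp qa pb pc (qd * q) hc1 hd2).
      exact (dpseries_diff_x q x y hq hx0 hx hy _ _ _ qd _
               (hbd qa pb) hbd' hbd' (Cexp_neq_0 _)
               (fun l k => psi1_coeff_sub_d q p hq hp qa pb pc qd l k hc1 hd1)).
    + exact (dpseries_diff_y p x y hp hx hy0 hy _ _ _ pb _
               (hbd qa pb) (hbd qa (pb * p)) (hbd qa pb) (Cexp_neq_0 _)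
               (fun l k => psi1_coeff_sub_b q p qa pb pc qd l k hb)).
    + assert (hbd' := psi1_coeff_bounded q p hq hp qa pb (pc * p) qd hc2 hd1).
      exact (dpseries_diff_y p x y hp hx hy0 hy _ _ _ pc _
               (hbd qa pb) hbd' hbd' (Cexp_neq_0 _)
               (fun l k => psi1_coeff_sub_c q p hq hp qa pb pc qd l k hc1 hd1)).
  - intros a b c hb hc qa pb qc Psi.
    assert (hb1 := neq_inv_pow p pb hp0 hb).
    assert (hc1 := neq_inv_pow q qc hq0 hc).
    assert (hb2 := shift_neq_1 pb p hb1); assert (hc2 := shift_neq_1 qc q hc1).
    assert (hbd := fun A => psi2_coeff_bounded q p hq hp A pb qc hb1 hc1).
    unfold Dqpar.
    rewrite !(bpow_succ lq q _ elq), !(bpow_succ lp p _ elp).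
    split; [intros ha; split|split].
    + exact (dpseries_diff_xy_x_first q p x y hq hp hx0 hx hy0 hy _ _ qa _
               (hbd qa) (hbd (qa * q)) (Cexp_neq_0 _)
               (fun l k => psi2_coeff_sub_a q p qa pb qc l k ha)).
    + exact (dpseries_diff_xy_y_first q p x y hq hp hx0 hx hy0 hy _ _ qa _
               (hbd qa) (hbd (qa * q)) (Cexp_neq_0 _)
               (fun l k => psi2_coeff_sub_a q p qa pb qc l k ha)).
    + assert (hbd' := psi2_coeff_bounded q p hq hp qa pb (qc * q) hb1 hc2).
      exact (dpseries_diff_x q x y hq hx0 hx hy _ _ _ qc _
               (hbd qa) hbd' hbd' (Cexp_neq_0 _)
               (fun l k => psi2_coeff_sub_c q p hq hp qa pb qc l k hb1 hc1)).
    + assert (hbd' := psi2_coeff_bounded q p hq hp qa (pb * p) qc hb2 hc1).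
      exact (dpseries_diff_y p x y hp hx hy0 hy _ _ _ pb _
               (hbd qa) hbd' hbd' (Cexp_neq_0 _)
               (fun l k => psi2_coeff_sub_b q p hq hp qa pb qc l k hb1 hc1)).
Qed.
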